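(* Let $\theta=(k_r)$ be a lacunary sequence with $\liminf_r q_r>1$ and let $A\subset\mathbb{R}$. The set $\Delta N_\theta WC(A)$ of all $N_\theta$-ward continuous functions on $A$ is a closed subset of the set $C(A)$ of all continuous real functions on $A$ (with respect to uniform convergence on $A$); that is, $\overline{\Delta N_\theta WC(A)}=\Delta N_\theta WC(A)$.
   Context: A lacunary sequence is an increasing sequence of integers $\theta=(k_r)_{r\ge 0}$ with $k_0=0$ and $h_r:=k_r-k_{r-1}\to\infty$. Put $I_r=(k_{r-1},k_r]$ (integers in this interval) and $q_r=k_r/k_{r-1}$ (for $r\ge 2$). A real sequence $(\alpha_k)_{k\ge1}$ is $N_\theta$-quasi-Cauchy if $\lim_{r\to\infty}\frac1{h_r}\sum_{k\in I_r}|\alpha_{k+1}-\alpha_k|=0$. A function $f:A\to\mathbb{R}$ is $N_\theta$-ward continuous on $A$ if $(f(\alpha_k))$ is $N_\theta$-quasi-Cauchy whenever $(\alpha_k)$ is an $N_\theta$-quasi-Cauchy sequence of points in $A$. $\overline{\Delta N_\theta WC(A)}$ denotes the set of all $f\in C(A)$ such that for every $\varepsilon>0$ there is $g\in\Delta N_\theta WC(A)$ with $|f(x)-g(x)|<\varepsilon$ for all $x\in A$. *)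

(* Defs.v *)
From mathcomp Require Import all_boot all_order all_algebra.
From mathcomp Require Import all_classical all_reals all_analysis.
Import Order.TTheory GRing.Theory Num.Theory.
Import numFieldNormedType.Exports.

Set Implicit Arguments.
Unset Strict Implicit.
Unset Printing Implicit Defensive.

Local Open Scope classical_set_scope.
Local Open Scope ring_scope.

(* h_r, meaningful for r >= 1; block_length k 0 = 0 is a dummy value that does
   not affect the limits as r tends to infinity. *)
Definition block_length (k : nat -> nat) (r : nat) : nat := (k r - k r.-1)%N.

(* Strict monotonicity and k 0 = 0 make every k r a natural number, so nat
   replaces the integers. *)
Definition lacunary (k : nat -> nat) : Prop :=
  [/\ k 0%N = 0%N, {homo k : m n / (m < n)%N} & block_length k @ \oo --> \oo].

(* q_r, meaningful for r >= 2 (k 1 > 0 when k is lacunary). *)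
Definition lacunary_ratio (R : realType) (k : nat -> nat) (r : nat) : R :=
  (k r)%:R / (k r.-1)%:R.

(* The range (k r.-1).+1 <= j < (k r).+1 is the integer interval
   (k_{r-1}, k_r]. For r >= 1 its indices are at least 1, so the term alpha 0,
   absent from sequences indexed from 1, is never used. *)
Definition Ntheta_mean (R : realType) (k : nat -> nat) (alpha : nat -> R)
    (r : nat) : R :=
  (block_length k r)%:R^-1
  * \sum_((k r.-1).+1 <= j < (k r).+1) `|alpha j.+1 - alpha j|.

Definition Ntheta_quasi_cauchy (R : realType) (k : nat -> nat)
    (alpha : nat -> R) : Prop :=
  Ntheta_mean k alpha @ \oo --> (0 : R).

Definition Ntheta_ward_continuous (R : realType) (k : nat -> nat) (A : set R)
    (f : A -> R) : Prop :=
  forall alpha : nat -> A,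
    Ntheta_quasi_cauchy k (fun j => set_val (alpha j)) ->
    Ntheta_quasi_cauchy k (fun j => f (alpha j)).

(* A carries the topology induced by the inclusion in R. *)
Definition continuous_functions (R : realType) (A : set R) : set (A -> R) :=
  [set f : A -> R | continuous f].

Definition Ntheta_ward_functions (R : realType) (k : nat -> nat) (A : set R) :
    set (A -> R) :=
  [set f : A -> R | Ntheta_ward_continuous k f].

Definition uniform_closure (R : realType) (A : set R) (F : set (A -> R)) :
    set (A -> R) :=
  [set f : A -> R | continuous_functions f /\
    forall e : R, 0 < e ->
      exists2 g : A -> R, F g & forall x : A, `|f x - g x| < e].

Arguments lacunary_ratio R k r : clear implicits.
Arguments continuous_functions {R} A.
Arguments Ntheta_ward_functions {R} k A.

(* Main.v *)
(* If an N_theta-ward continuous f were discontinuous at a, some x_n -> a in A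
   would keep f x_n at distance at least e from f a.  Interleaving the x_n with
   the constant a gives a sequence whose steps tend to 0, hence which is
   N_theta-quasi-Cauchy, while all the steps of its image have size at least e,
   and so do all the block means.  Closedness: if |f - g| < e then every step of
   f along a sequence exceeds that of g by at most 2e, so the block means do as
   well. *)
Require Import Defs.
From mathcomp Require Import all_boot all_order all_algebra.
From mathcomp Require Import all_classical all_reals all_analysis.
From mathcomp Require Import lra.
Import Order.TTheory GRing.Theory Num.Theory.
Import numFieldNormedType.Exports.

Local Open Scope classical_set_scope.
Local Open Scope ring_scope.

(** Balls of the induced topology on [A] are traces of balls of [R], so the epsilon-delta criterion
    applies directly. *)
Lemma subtype_continuous_dist {R : realType} {A : set R} (f : A -> R) :
  (forall (a : A) (e : R), 0 < e -> exists2 d : R, 0 < d &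
     forall x : A, `|set_val a - set_val x| < d -> `|f a - f x| < e) ->
  continuous f.
Proof.
move=> fP a; apply/(cvgrPdist_lt (FF := nbhs_filter a)) => e e0.
have [d d0 fd] := fP a e e0.
by apply/nbhs_ballP; exists d => //= x; exact: fd.
Qed.

Lemma Ntheta_mean_ge0 (R : realType) (k : nat -> nat) (alpha : nat -> R) r :
  0 <= Ntheta_mean k alpha r.
Proof. by rewrite mulr_ge0 ?invr_ge0 ?sumr_ge0. Qed.

Lemma Ntheta_mean_cst (R : realType) (k : nat -> nat) (c : R) r :
  Ntheta_mean k (fun=> c) r = 0.
Proof. by rewrite /Ntheta_mean big1 ?mulr0// => j _; rewrite subrr normr0. Qed.

Lemma sum_Ntheta_block_cst (R : realType) (k : nat -> nat) (e : R) r :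
  \sum_((k r.-1).+1 <= j < (k r).+1) e = e *+ block_length k r.
Proof. by rewrite sumr_const_nat subSS. Qed.

Lemma Ntheta_mean_le (R : realType) (k : nat -> nat) (alpha beta : nat -> R)
    (e : R) r : 0 <= e ->
  (forall j, (k r.-1 < j)%N ->
     `|alpha j.+1 - alpha j| <= e + `|beta j.+1 - beta j|) ->
  Ntheta_mean k alpha r <= e + Ntheta_mean k beta r.
Proof.
move=> e0 le_ab; apply: (@le_trans _ _ ((block_length k r)%:R^-1 *
   \sum_((k r.-1).+1 <= j < (k r).+1) (e + `|beta j.+1 - beta j|))).
  rewrite ler_wpM2l ?invr_ge0//.
  by rewrite ler_sum_nat// => j /andP[kj _]; exact: le_ab.
rewrite big_split/= sum_Ntheta_block_cst mulrDr lerD2r.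
(* On an empty block the average of the constant [e] is 0 instead of [e]; this is where [0 <= e]
   enters. *)
have [->|h0] := eqVneq (block_length k r) 0%N; first by rewrite mulr0n mulr0.
by rewrite -(mulr_natl e) mulKf ?pnatr_eq0.
Qed.

Lemma Ntheta_mean_ge (R : realType) (k : nat -> nat) (alpha : nat -> R)
    (e : R) r : (0 < block_length k r)%N ->
  (forall j, e <= `|alpha j.+1 - alpha j|) -> e <= Ntheta_mean k alpha r.
Proof.
move=> h0 le_e; rewrite /Ntheta_mean ler_pdivlMl ?ltr0n// mulr_natl.
by rewrite -sum_Ntheta_block_cst ler_sum.
Qed.

Lemma lacunary_geid {k : nat -> nat} : lacunary k -> forall r, (r <= k r)%N.
Proof.
by move=> [_ kS _]; elim=> // r rk; rewrite (leq_ltn_trans rk)// kS.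
Qed.

Lemma lacunary_block_length_gt0 {k : nat -> nat} :
  lacunary k -> forall r, (0 < block_length k r.+1)%N.
Proof. by move=> [_ kS _] r; rewrite subn_gt0 kS. Qed.

(** Block [r.+1] starts after [k r >= r], so for large [r] all its steps are small, and so is their
    average. *)
Lemma Ntheta_quasi_cauchy_steps (R : realType) (k : nat -> nat)
    (alpha : nat -> R) : lacunary k ->
  alpha j.+1 - alpha j @[j --> \oo] --> (0 : R) -> Ntheta_quasi_cauchy k alpha.
Proof.
move=> hk /cvgr0Pnorm_le step; apply/cvgr0Pnorm_le => e e0.
have [N _ stepN] := step e e0.
exists N.+1 => // -[//|r] /=; rewrite ltnS => Nr.
(* Comparison with the zero sequence, whose mean vanishes, turns [Ntheta_mean_le] into a plain bound
   by [e]. *)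
rewrite ger0_norm ?Ntheta_mean_ge0// -[e]addr0 -(Ntheta_mean_cst R k 0 r.+1).
apply: Ntheta_mean_le => [|j kj]; first exact: ltW.
rewrite subrr normr0 addr0.
apply: stepN => /=; rewrite (leq_trans Nr)// (leq_trans (lacunary_geid hk r))//.
exact: ltnW.
Qed.

Lemma Ntheta_ward_functions_continuous (R : realType) (k : nat -> nat)
    (A : set R) : lacunary k ->
  Ntheta_ward_functions k A `<=` continuous_functions A.
Proof.
move=> hk f wf; apply: subtype_continuous_dist => a e e0.
apply: contrapT => nod.
have /choice[x xP] (n : nat) : exists x : A,
    `|set_val a - set_val x| < n.+1%:R^-1 /\ e <= `|f a - f x|.
  apply: contrapT => nox; apply: nod; exists n.+1%:R^-1 => [|x ax].
    by rewrite invr_gt0.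
  by rewrite ltNge; apply/negP => fx; apply: nox; exists x.
(* Two consecutive indices differ in parity, so each step compares [a] with [x j] or [x j.+1]. *)
pose alpha j := if odd j then a else x j.
have qc : Ntheta_quasi_cauchy k (fun j => set_val (alpha j)).
  apply: (Ntheta_quasi_cauchy_steps _ _ _ hk); apply/cvgr0Pnorm_lt => d d0.
  have [N _ HN] := near_infty_natSinv_lt (PosNum d0).
  exists N => // j Nj; rewrite /alpha /=; case: (odd j) => /=.
    rewrite distrC (lt_trans (xP _).1)//; apply: HN.
    exact: leq_trans Nj (leqnSn j).
  by rewrite (lt_trans (xP _).1)//; exact: HN.
(* Index [N.+1] rather than [N]: block 0 is empty and has mean 0, while every later block is
   nonempty. *)
have /cvgr0Pnorm_lt/(_ e e0)[N _ /(_ N.+1 (leqnSn N))] := wf alpha qc.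
apply/negP; rewrite -leNgt ger0_norm ?Ntheta_mean_ge0//.
apply: Ntheta_mean_ge; first exact: lacunary_block_length_gt0.
move=> j; rewrite /alpha /=; case: (odd j) => /=; last exact: (xP _).2.
by rewrite distrC; exact: (xP _).2.
Qed.

Lemma Ntheta_ward_functions_closed (R : realType) (k : nat -> nat)
    (A : set R) :
  uniform_closure (Ntheta_ward_functions k A) `<=` Ntheta_ward_functions k A.
Proof.
move=> f [_ fg] alpha qc; apply/cvgr0Pnorm_lt => e e0.
(* Two approximation errors cost [e / 2] and the mean of [g] less than [e / 4], in total less than
   [e]. *)
have e4 : 0 < e / 4 by rewrite divr_gt0.
have [g wg lt_fg] := fg _ e4.
have /cvgr0Pnorm_lt/(_ _ e4) := wg alpha qc.
apply: filterS => r; rewrite !ger0_norm ?Ntheta_mean_ge0// => lt_g.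
have : Ntheta_mean k (fun j => f (alpha j)) r
    <= e / 2 + Ntheta_mean k (fun j => g (alpha j)) r; last by lra.
apply: Ntheta_mean_le => [|j _]; first by lra.
have := lt_fg (alpha j); have := lt_fg (alpha j.+1).
set u := f _; set v := g _; set u' := f _; set v' := g _ => uv uv'.
have -> : u - u' = (u - v) - (u' - v') + (v - v') by lra.
apply: (le_trans (ler_normD _ _)); rewrite lerD2r.
by apply: (le_trans (ler_normB _ _)); lra.
Qed.

Theorem theorem22 (R : realType) (k : nat -> nat) (A : set R)
  (hk : lacunary k)
  (hq : (1%:E < limn_einf (fun r : nat => (lacunary_ratio R k r.+2)%:E))%E) :
  Ntheta_ward_functions k A `<=` continuous_functions A /\
  uniform_closure (Ntheta_ward_functions k A)
    = Ntheta_ward_functions k A.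
Proof.
have wc := @Ntheta_ward_functions_continuous R k A hk.
split=> //; rewrite eqEsubset; split; first exact: Ntheta_ward_functions_closed.
(* The closure is taken inside the continuous functions, so this inclusion needs [wc]; [f] then
   approximates itself. *)
move=> f wf; split; first exact: wc.
by move=> e e0; exists f => // x; rewrite subrr normr0.
Qed.
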